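(* Let $H$ be a finite connected plane multigraph without loops such that every face has degree at most $4$. Then it is possible to add a chord to every quadrangle of $H$ such that the graph formed by the added chords is a forest. Moreover, these chords can be chosen so that, in addition, for any pair $a,b$ of vertices that are adjacent in $H$, there is no path from $a$ to $b$ consisting only of added chords.
   Context: $H$ is drawn in the plane without crossings (multiple edges allowed). Faces are the maximal connected regions of the plane minus the drawing. At each vertex, two edges consecutive in the rotational order of incident edges form an angle; the degree of a face is the number of angles contained in it. A quadrangle is a face of degree 4 (its boundary may contain fewer than 4 distinct vertices when there are parallel edges). Adding a chord to a face $f$ means adding an edge between two non-adjacent vertices on the boundary of $f$, drawn through the region of $f$. *)

(* Defs.v *)
(* A crossing-free plane drawing of a connected multigraph is represented, as
   usual, by its combinatorial map (the rotational order of the half-edges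
   around every vertex), subject to Euler's formula. *)
From mathcomp Require Import all_boot.

Set Implicit Arguments.
Unset Strict Implicit.
Unset Printing Implicit Defensive.

(* A dart is an edge together with one of its two orientations; [rev] reverses
   it.  The edges are the pairs {d, rev d}, so loops and parallel edges are
   allowed.  [rot d] is the dart that follows [d] in the rotational order around
   [src d].  Vertices are kept separate from the darts so that the graph with a
   single vertex and no edge is included. *)
Record plmap := Plmap {
  vertex : finType;
  dart : finType;
  src : dart -> vertex;
  rev : dart -> dart;
  rot : dart -> dart;
  revK : involutive rev;
  rev_neq : forall d, rev d != d;
  rot_inj : injective rot;
  rot_src : forall d d', fconnect rot d d' = (src d == src d')
}.

Section Plmap.

Variable H : plmap.

Definition tgt (d : dart H) : vertex H := src (rev d).

Definition adjacent : rel (vertex H) :=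
  [rel u v | [exists d : dart H, (src d == u) && (tgt d == v)]].

Definition loopless : Prop := forall d : dart H, src d != tgt d.

Definition connected_graph : Prop :=
  0 < #|vertex H| /\ forall u v : vertex H, connect adjacent u v.

(* An angle is a pair (d, rot d); it is represented by its second dart, so the
   angles are in bijection with the darts, and [d] stands for an angle at
   [src d].  If [rot] is counterclockwise, walking along [d] with a face on the
   right-hand side, the next angle of that face is between [rev d] and
   [rot (rev d)]. *)
Definition face_next (d : dart H) : dart H := rot (rev d).

Definition face_of (d : dart H) : {set dart H} :=
  [set x | fconnect face_next d x].

(* A face is identified with the set of angles it contains.  Without edges
   the plane minus the drawing is one face, which contains no angle. *)
Definition faces : {set {set dart H}} :=
  if #|dart H| == 0 then [set set0] else [set face_of d | d in [set: dart H]].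

Definition face_degree (f : {set dart H}) : nat := #|f|.

Definition n_edges : nat := fcard (@rev H) (dart H).

(* For a connected map, Euler's formula says that the surface carrying the map
   is the sphere; the outer face of the plane drawing is one of [faces]. *)
Definition planar : Prop := #|vertex H| + #|faces| = n_edges + 2.

Definition quadrangle : finType :=
  {f : {set dart H} | (f \in faces) && (face_degree f == 4)}.

(* The chord drawn inside [q] from the angle [x.1] to the angle [x.2]. *)
Definition is_chord (q : quadrangle) (x : dart H * dart H) : Prop :=
  [/\ x.1 \in val q, x.2 \in val q, src x.1 != src x.2
    & ~~ adjacent (src x.1) (src x.2)].

Definition chord_ends (c : quadrangle -> dart H * dart H) (q : quadrangle) :
  vertex H * vertex H := (src (c q).1, src (c q).2).

End Plmap.

(* The multigraph on [V] with edge set [E] and endpoints [ends]. *)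
Section Multigraph.

Variables (V E : finType) (ends : E -> V * V).

Definition joins (e : E) (u v : V) : bool :=
  (ends e == (u, v)) || (ends e == (v, u)).

(* A cycle is a nonempty cyclic sequence of pairs (v_i, e_i), with distinct
   vertices and distinct edges, where e_i joins v_i to v_(i+1).  Length 1 is a
   loop, length 2 a pair of parallel edges. *)
Definition graph_cycle (c : seq (V * E)) : bool :=
  [&& c != [::], uniq (unzip1 c), uniq (unzip2 c)
    & cycle [rel x y | joins x.2 x.1 y.1] c].

Definition forest : Prop := forall c : seq (V * E), ~~ graph_cycle c.

Definition edge_rel : rel V := [rel u v | [exists e, joins e u v]].

End Multigraph.

(* Main.v *)
Require Import Defs.
From mathcomp Require Import all_boot all_fingroup zify.

Set Implicit Arguments.
Unset Strict Implicit.
Unset Printing Implicit Defensive.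

(** A chord of a quadrangle [f] with ends [u] and [v] is added by merging [u]
    and [v] through [f].  In terms of rotations this multiplies [rot], and hence
    also the face permutation, by the transposition of the two angles: the
    number of vertices drops by one, [f] splits into two digons, and the map
    stays planar, connected and, if [u] and [v] are distinct and not adjacent,
    loopless.  Iterating over all quadrangles ends with a loopless map in which
    every chord has been contracted, each time between two different vertices.
    Hence the chords form a forest, and no chord path joins the ends of an edge.

    Let a, b, c, d be the corners of a quadrangle.  If a = c, or a and c are
    adjacent, then b and d are different and not adjacent: otherwise, splitting
    a = c through the face (after merging a with c, deleting the edge ac, and
    separating its two sides) would leave too few components for the nonnegativity
    of the genus. *)

Local Open Scope group_scope.

(** * Equivalence closures, cycle counts and the genus inequality *)

Section EquivalenceClosure.

Variable D : finType.
Implicit Types (g h : rel D) (s t : {perm D}).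

Definition eqclos g : rel D := connect [rel x y | g x y || g y x].

Lemma eqclos_refl g x : eqclos g x x.
Proof. exact: connect0. Qed.

Lemma eqclos_sym g x y : eqclos g x y = eqclos g y x.
Proof. by apply: sym_connect_sym => u v; rewrite /= orbC. Qed.

Lemma eqclos_trans g y x z : eqclos g x y -> eqclos g y z -> eqclos g x z.
Proof. exact: connect_trans. Qed.

Lemma eqclos_same g x y z : eqclos g x y -> eqclos g x z = eqclos g y z.
Proof.
move=> xy; apply/idP/idP; last exact: eqclos_trans.
by apply: eqclos_trans; rewrite eqclos_sym.
Qed.

Lemma eqclos1 g x y : g x y -> eqclos g x y.
Proof. by move=> gxy; apply: connect1; rewrite /= gxy. Qed.

Lemma eqclos_sub g h x y :
  (forall u v, g u v -> eqclos h u v) -> eqclos g x y -> eqclos h x y.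
Proof.
move=> gh; apply: connect_sub => u v /= /orP[/gh // | /gh].
by rewrite eqclos_sym.
Qed.

Lemma eqclos_invariant (P : pred D) g x y :
  (forall u v, g u v -> P u = P v) -> eqclos g x y -> P x = P y.
Proof.
move=> gP /connectP[p]; elim: p x => [|z p IHp] x /= => [_ -> //|].
by case/andP=> /orP[] /gP e /IHp{}IHp /IHp <-.
Qed.

Lemma eqclos_porbit g s x y :
  (forall z, porbit s z = porbit s x -> eqclos g z (s z)) ->
  porbit s x = porbit s y -> eqclos g x y.
Proof.
move=> gs /eqP; rewrite eq_sym eq_porbit_mem => /porbitP[i ->{y}].
elim: i => [|i IHi]; first by rewrite expg0 perm1 eqclos_refl.
by rewrite expgSr permM (eqclos_trans IHi) // gs // porbit_perm.
Qed.

Lemma porbit_perm1 s x : porbit s (s x) = porbit s x.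
Proof. by have := porbit_perm s 1 x; rewrite expg1. Qed.

Definition ncycles s := #|porbits s|.

Lemma ncycles_mul_tperm s x y : x != y ->
  ncycles (s * tperm x y) =
  if porbit s x == porbit s y then (ncycles s).+1 else (ncycles s).-1.
Proof.
(* [porbits_mul_tperm] multiplies on the left; inverting the product turns this into right
   multiplication without changing the orbits. *)
move=> nxy; have := porbits_mul_tperm s^-1 x y; rewrite /= -!/(ncycles _) nxy.
have -> : ncycles (tperm x y * s^-1) = ncycles (s * tperm x y).
  by rewrite /ncycles -porbitsV invMg invgK tpermV.
rewrite {2}/ncycles porbitsV -/(ncycles s) porbitV eq_porbit_mem.
by case: (x \in _) => /=; lia.
Qed.

Lemma ncycles_gt0 s (x : D) : 0 < ncycles s.
Proof. by apply/card_gt0P; exists (porbit s x); rewrite imset_f. Qed.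

Lemma ncycles_split s x y : x != y -> porbit s x = porbit s y ->
  ncycles (s * tperm x y) = (ncycles s).+1.
Proof. by move=> nxy exy; rewrite ncycles_mul_tperm // exy eqxx. Qed.

Lemma ncycles_merge s x y : porbit s x != porbit s y ->
  (ncycles (s * tperm x y)).+1 = ncycles s.
Proof.
move=> nsxy; have nxy : x != y by apply: contraNneq nsxy => ->.
by rewrite ncycles_mul_tperm // (negPf nsxy) prednK // (ncycles_gt0 s x).
Qed.

(** Multiplying twice by the transposition restores [s], so of the two changes in the number of
    cycles one is a split and the other a merge. *)
Lemma porbit_mul_tperm s x y : x != y ->
  (porbit (s * tperm x y) x == porbit (s * tperm x y) y)
  = (porbit s x != porbit s y).
Proof.
move=> nxy; have := ncycles_mul_tperm s nxy.
have := ncycles_mul_tperm (s * tperm x y) nxy.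
rewrite -mulgA tperm2 mulg1; have := ncycles_gt0 s x.
by do 2!case: (_ == _) => /=; lia.
Qed.

Lemma ncycles1 : ncycles 1 = #|D|.
Proof.
rewrite /ncycles /porbits card_imset // => x y /eqP; rewrite eq_porbit_mem.
by case/porbitP=> i ->; rewrite expg1n perm1.
Qed.

Lemma ncycles_le s : ncycles s <= #|D|.
Proof. exact: leq_trans (leq_imset_card _ _) (leqnn _). Qed.

Definition steps s t : rel D := [rel x y | (y == s x) || (y == t x)].

Lemma eqclos_stepl s t x : eqclos (steps s t) x (s x).
Proof. by apply: eqclos1; rewrite /steps /= eqxx. Qed.

Lemma eqclos_stepr s t x : eqclos (steps s t) x (t x).
Proof. by apply: eqclos1; rewrite /steps /= eqxx orbT. Qed.

(* Nonnegativity of the genus.  Multiplying [t] by a transposition changes the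
   numbers of cycles of [t] and of [s * t] by one each; both increase only if
   the number of components decreases. *)
Lemma genus_ineq s t (W : {set D}) :
  (forall x, exists2 w, w \in W & eqclos (steps s t) x w) ->
  ncycles s + ncycles t + ncycles (s * t) <= #|D| + #|W|.*2.
Proof.
have [k] := ubnP (#|D| - ncycles t).
elim: k => // k IHk in t W *; move=> le_k domW.
have [t1 | /existsP[y ty]] := boolP [forall y, t y == y]; last first.
  set z := t y in ty.
  have nyz: y != z by rewrite eq_sym.
  pose t' : {perm D} := t * tperm y z.
  have def_t: t = t' * tperm y z by rewrite -mulgA tperm2 mulg1.
  have def_st: s * t = (s * t') * tperm y z by rewrite -mulgA -def_t.
  have Nt : ncycles t' = (ncycles t).+1.
    by apply: ncycles_split => //; rewrite porbit_perm1.
  have lt_k: #|D| - ncycles t' < k by have := ncycles_le t'; lia.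
  have Nst := ncycles_mul_tperm (s * t') nyz; rewrite -def_st in Nst.
  pose P (W : {set D}) x := [exists w in W, eqclos (steps s t') x w].
  have P_inv W' u v : steps s t' u v -> P W' u = P W' v.
    move=> /eqclos1 uv; apply: eq_existsb => w; congr (_ && _).
    exact: eqclos_same.
  have domP (W' : {set D}) : W \subset W' -> P W' y = P W' z ->
      forall x, exists2 w, w \in W' & eqclos (steps s t') x w.
    move=> sWW' Pyz x; apply/exists_inP; rewrite -/(P W' x).
    have [w Ww /(@eqclos_invariant (P W'))->] := domW x.
      by apply/exists_inP; exists w; rewrite ?eqclos_refl ?(subsetP sWW').
    move=> u v /= /orP[]/eqP-> {v}; first by apply: P_inv; rewrite /steps /= eqxx.
    rewrite def_t permM (@P_inv W' u (t' u)) /steps /= ?eqxx ?orbT //.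
    by case: tpermP => // ->.
  (* If [W] reaches both or neither of [y] and [z] without the transposition, it still meets every
     component for [t']. *)
  have [Pyz | nPyz] := eqVneq (P W y) (P W z).
    by have := IHk t' W lt_k (domP W (subxx W) Pyz); move: Nst; case: eqP; lia.
  (* Otherwise [y] and [z] lie in different components for [t'], so passing to [s * t] merges two
     cycles. One new representative [v] adds two to the bound, which pays for the extra cycle of
     [t'] and that of [s * t']. *)
  have orb: porbit (s * t') y != porbit (s * t') z.
    apply: contra_neq nPyz => /eqclos_porbit yz.
    apply: (@eqclos_invariant _ (steps s t')); first exact: P_inv.
    apply: yz => u _; rewrite permM (eqclos_trans (eqclos_stepl s t' u)) //.
    exact: eqclos_stepr.
  pose v := if P W y then z else y.
  have Pv x : P W x || (x == v) -> P (v |: W) x.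
    case/orP=> [/exists_inP[w Ww xw]| /eqP->]; apply/exists_inP.
      by exists w; rewrite // setU1r.
    by exists v; rewrite ?setU11 ?eqclos_refl.
  have Py : P (v |: W) y.
    by apply: Pv; rewrite /v; case: (P W y); rewrite //= eqxx.
  have Pz : P (v |: W) z.
    apply: Pv; rewrite /v; move: nPyz; case: (P W y); rewrite /= ?eqxx ?orbT //.
    by case: (P W z).
  have := IHk t' (v |: W) lt_k (domP _ (subsetUr _ _) (etrans Py (esym Pz))).
  have := ncycles_gt0 (s * t') y; move: Nst; rewrite (negPf orb).
  by rewrite cardsU1; case: (v \in W) => /=; lia.
have {}t1 : t = 1 by apply/permP=> x; rewrite perm1 (eqP (forallP t1 x)).
(* For [t = 1] the components are the cycles of [s], and [W] meets each of them. *)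
suff : ncycles s <= #|W| by rewrite t1 mulg1 ncycles1; lia.
apply: leq_trans (leq_imset_card (porbit s) (mem W)); apply: subset_leq_card.
apply/subsetP=> _ /imsetP[x _ ->]; have [w Ww xw] := domW x.
apply/imsetP; exists w => //; apply/eqP.
rewrite (@eqclos_invariant (fun u => porbit s u == porbit s w) _ _ _ _ xw) //.
by move=> u v /orP[]/eqP->; rewrite ?porbit_perm1 // t1 perm1.
Qed.

Lemma porbit_invariant_in (T : Type) (P : D -> T) s x y :
  (forall z, porbit s z = porbit s x -> P (s z) = P z) ->
  porbit s x = porbit s y -> P x = P y.
Proof.
move=> Ps /esym/eqP; rewrite eq_porbit_mem => /porbitP[i ->].
by elim: i => [|i IHi]; rewrite ?perm1 // expgSr permM Ps // porbit_perm.
Qed.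

Lemma porbit_invariant (T : Type) (P : D -> T) s x y :
  (forall z, P (s z) = P z) -> porbit s x = porbit s y -> P x = P y.
Proof. by move=> Ps; apply: porbit_invariant_in. Qed.

Lemma porbit_fixed s x y : s x = x -> porbit s y = porbit s x -> y = x.
Proof.
move=> sx /eqP; rewrite eq_porbit_mem => /porbitP[i ->].
by rewrite permX iter_fix.
Qed.

Lemma porbit_merge s x y z w : porbit s x != porbit s y ->
  porbit s z = porbit s w ->
  porbit (s * tperm x y) z = porbit (s * tperm x y) w.
Proof.
move=> nsxy; have nxy : x != y by apply: contraNneq nsxy => ->.
have /eqP exy : porbit (s * tperm x y) x == porbit (s * tperm x y) y.
  by rewrite porbit_mul_tperm.
apply: porbit_invariant => u; rewrite -[RHS]porbit_perm1 permM.
by case: tpermP => [->|->|].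
Qed.

Lemma tperm_invariant (T : eqType) (P : D -> T) x y u :
  P x = P y -> P (tperm x y u) = P u.
Proof. by move=> Pxy; case: tpermP => [->|->|]. Qed.

(** Starting from [s e], [t] follows the cycle of [s] as far as the predecessor of [x], where it
    turns off to [w]. *)
Lemma porbit_reroute s t e x w :
  porbit s e = porbit s x -> e != x -> s e != x ->
  (forall z, s z = x -> t z = w) ->
  (forall z, porbit s z = porbit s e ->
     s z != x -> s z != e -> s z != s e -> t z = s z) ->
  porbit t (s e) = porbit t w.
Proof.
move=> /esym/eqP; rewrite eq_porbit_mem => /porbitP[i def_x] nex nsex tx ts.
(* The walk from [e] is back at [e], or is still on the [t]-cycle of [s e] and not at [x], or has
   already met [x]. *)
suff: [\/ (s ^+ i) e = e,
          porbit t (s e) = porbit t ((s ^+ i) e) /\ (s ^+ i) e != x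
        | porbit t (s e) = porbit t w].
  rewrite -def_x; case=> [ex | [_] |] //; last by rewrite eqxx.
  by rewrite ex eqxx in nex.
elim: i {def_x} => [|i IHi]; first by constructor 1; rewrite perm1.
rewrite expgSr permM; set z := (s ^+ i) e in IHi *.
have sz : porbit s z = porbit s e by rewrite porbit_perm.
have [szx | nszx] := eqVneq (s z) x.
  constructor 3; case: IHi => [ze | [ez _] | //].
    by rewrite -ze szx eqxx in nsex.
  by rewrite ez -(tx z szx) porbit_perm1.
have [| nsze] := eqVneq (s z) e; first by constructor 1.
have [sze | nszse] := eqVneq (s z) (s e); first by constructor 2; rewrite sze; split.
case: IHi => [ze | [ez _] |]; last by constructor 3.
  by rewrite ze eqxx in nszse.
by constructor 2; split; rewrite // ez -(ts z) // porbit_perm1.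
Qed.

End EquivalenceClosure.

(** * Spherical maps as pairs of permutations *)

Section DartPermutations.

Variables (D : finType) (r : {perm D}).
Hypothesis rK : involutive r.
Implicit Types s t : {perm D}.

(** Darts stand for their vertices, the cycles of [s]. A chord may be contracted exactly when its
    two angles are not linked. *)
Definition linked s x y :=
  (porbit s x == porbit s y) ||
  [exists d, (porbit s d == porbit s x) && (porbit s (r d) == porbit s y)].

(** Looplessness makes every cycle of [r] have two darts, so [sphere_euler] is Euler's formula,
    written in the form of the bound in [genus_ineq]. *)
Record sphere_map s : Prop := SphereMap {
  sphere_euler : ncycles r + ncycles s + ncycles (r * s) = #|D| + 2;
  sphere_conn : forall x y, eqclos (steps r s) x y;
  sphere_loopless : forall d, porbit s d != porbit s (r d) }.

(** Used for surgeries that leave the vertices of [x] and [y] intact: the link between them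
    survives. *)
Lemma linked_eqclos s t x y :
  (forall z, porbit s z = porbit s x \/ porbit s z = porbit s y -> t z = s z) ->
  linked s x y -> eqclos (steps r t) x y.
Proof.
move=> ts.
have orb z w : porbit s z = porbit s x \/ porbit s z = porbit s y ->
    porbit s z = porbit s w -> eqclos (steps r t) z w.
  move=> zxy; apply: eqclos_porbit => u uz.
  by rewrite -(ts u) ?uz //; apply: eqclos_stepr.
case/orP=> [/eqP | /existsP[d /andP[/eqP dx /eqP dy]]].
  by apply: orb; left.
apply: (eqclos_trans (y := d)); first by apply: orb; [left | ].
by apply: eqclos_trans (eqclos_stepl _ _ _) (orb _ _ _ dy); right.
Qed.

(** * Opposite corners of a quadrangle: at most one pair is linked *)

Variables (s : {perm D}) (x1 x2 x3 x4 : D).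
Hypothesis sphS : sphere_map s.
Hypotheses (def2 : x2 = s (r x1)) (def3 : x3 = s (r x2)).
Hypotheses (def4 : x4 = s (r x3)) (def1 : x1 = s (r x4)).

Let n12 : porbit s x1 != porbit s x2.
Proof. by rewrite def2 porbit_perm1 sphere_loopless. Qed.
Let n23 : porbit s x2 != porbit s x3.
Proof. by rewrite def3 porbit_perm1 sphere_loopless. Qed.
Let n34 : porbit s x3 != porbit s x4.
Proof. by rewrite def4 porbit_perm1 sphere_loopless. Qed.
Let n41 : porbit s x4 != porbit s x1.
Proof. by rewrite def1 porbit_perm1 sphere_loopless. Qed.

Let f12 : porbit (r * s) x1 = porbit (r * s) x2.
Proof. by rewrite def2 -permM porbit_perm1. Qed.
Let f13 : porbit (r * s) x1 = porbit (r * s) x3.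
Proof. by rewrite f12 def3 -permM porbit_perm1. Qed.

(** Splitting the common vertex between [x1] and [x3] adds one vertex and one face, so [genus_ineq]
    requires two components. The link from [x2] to [x4] leaves only one. *)
Lemma same_vertex_not_linked :
  x1 != x3 -> porbit s x1 = porbit s x3 -> ~~ linked s x2 x4.
Proof.
move=> n13 e13; pose t := s * tperm x1 x3; apply/negP => l24.
have Ns : ncycles t = (ncycles s).+1 by apply: ncycles_split.
have Nf : ncycles (r * t) = (ncycles (r * s)).+1.
  by rewrite mulgA; apply: ncycles_split.
have ts z : porbit s z != porbit s x1 -> t z = s z.
  by move=> nz; rewrite permM tpermD //; apply: contraNneq nz => nz;
     rewrite -porbit_perm1 -nz ?e13.
have q12 : eqclos (steps r t) x1 x2.
  apply: eqclos_trans (eqclos_stepl _ _ _) _.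
  rewrite def2 -(ts (r x1)); first exact: eqclos_stepr.
  by rewrite eq_sym sphere_loopless.
have q34 : eqclos (steps r t) x3 x4.
  apply: eqclos_trans (eqclos_stepl _ _ _) _.
  rewrite def4 -(ts (r x3)); first exact: eqclos_stepr.
  by rewrite e13 eq_sym sphere_loopless.
have q24 : eqclos (steps r t) x2 x4.
  apply: linked_eqclos l24 => z zz; apply: ts.
  by case: zz => ->; rewrite // eq_sym.
have q13 : eqclos (steps r t) x3 x1.
  rewrite eqclos_sym (eqclos_trans q12) // (eqclos_trans q24) //.
  by rewrite eqclos_sym.
have dom x : exists2 w, w \in [set x1] & eqclos (steps r t) x w.
  exists x1; first exact: set11.
  pose P u := eqclos (steps r t) u x1.
  have Pinv u v : eqclos (steps r t) u v -> P u = P v by apply: eqclos_same.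
  rewrite -/(P x) (eqclos_invariant _ (sphere_conn sphS x x1)).
    exact: eqclos_refl.
  move=> u v /orP[]/eqP->; first exact/Pinv/eqclos_stepl.
  (* [s u] and [t u] differ at most by exchanging [x1] and [x3], which lie in one component. *)
  rewrite -(@tperm_invariant _ _ P x1 x3 (s u)); last by rewrite /P q13 eqclos_refl.
  by rewrite -permM; apply/Pinv/eqclos_stepr.
have := genus_ineq dom; rewrite cards1 Ns Nf; have := sphere_euler sphS.
by clear; lia.
Qed.

(** The surgery adds two vertices and two faces, so [genus_ineq] requires three components. With
    [x2] and [x4] linked, there are at most two: that of [x1] and that of the isolated edge [e]. *)
Lemma adjacent_not_linked e : porbit s x1 != porbit s x3 ->
  porbit s e = porbit s x1 -> porbit s (r e) = porbit s x3 -> ~~ linked s x2 x4.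
Proof.
move=> n13 ve vre; apply/negP=> l24.
set e' := r e in vre; pose p := s e; pose q := s e'.
have vp : porbit s p = porbit s x1 by rewrite porbit_perm1.
have vq : porbit s q = porbit s x3 by rewrite porbit_perm1.
have re' : r e' = e by rewrite /e' rK.
have diff u v : porbit s u = porbit s x1 -> porbit s v = porbit s x3 ->
    (u != v) * (v != u).
  move=> uu vv; rewrite [v == u]eq_sym; suff -> : u != v by [].
  by apply: contraNneq n13 => uv; rewrite -uu -vv uv.
(* In this and the next claim, an equality would put two consecutive corners of the quadrangle at
   one vertex, making a side a loop. *)
have [px1 px3] : x1 != e /\ x3 != e'.
  split; apply/eqP=> E.
    by move: n23; rewrite def2 porbit_perm1 E -/e' vre eqxx.
  by move: n41; rewrite def4 porbit_perm1 E re' ve eqxx.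
have [np1 nq3] : p != x1 /\ q != x3.
  split; apply/eqP=> E.
    have E4 : e' = x4.
      by rewrite /e' -(rK x4); congr (r _); apply: (@perm_inj _ s); rewrite -def1.
    by move: n34; rewrite -vre E4 eqxx.
  have E2 : e = x2.
    by rewrite -re' -(rK x2); congr (r _); apply: (@perm_inj _ s); rewrite -def3.
  by move: n12; rewrite -ve E2 eqxx.
have nep : e != p.
  by apply: contraNneq px1 => E; apply/eqP/(porbit_fixed (esym E)).
have neq : e' != q.
  by apply: contraNneq px3 => E; apply/eqP/(porbit_fixed (esym E)).
have nee := diff _ _ ve vre; have npq := diff _ _ vp vq.
have n1q := diff _ _ (erefl _) vq; have n1e' := diff _ _ (erefl _) vre.
have neq' := diff _ _ ve vq; have ne3 := diff _ _ ve (erefl _).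
have np3 := diff _ _ vp (erefl _); have npe' := diff _ _ vp vre.
have n13' := diff _ _ (erefl _) (erefl _).
have sym (u v : D) : (u != v) -> (u != v) * (v != u).
  by move=> uv; rewrite [v == u]eq_sym uv.
have {}px1 := sym _ _ px1; have {}px3 := sym _ _ px3.
have {}np1 := sym _ _ np1; have {}nq3 := sym _ _ nq3.
have {}nep := sym _ _ nep; have {}neq := sym _ _ neq.
pose ne := (nee, npq, n1q, n1e', neq', ne3, np3, npe', n13', (px1, px3, np1, nq3, nep, neq)).
(* [s1] merges the vertices of [x1] and [x3], so that the edge [e] becomes a
   loop; [s2] splits the merged vertex between the two ends of [e], and [s3] and
   [s4] then detach these ends, making [e] a component of its own. *)
pose s1 := s * tperm x1 x3; pose s2 := s1 * tperm e e'.
pose s3 := s2 * tperm e p; pose s4 := s3 * tperm e' q.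
have s4E z : s4 z = tperm e' q (tperm e p (tperm e e' (tperm x1 x3 (s z)))).
  by rewrite !permM.
have s2e : s2 e = p by rewrite !permM -/p !tpermD ?ne.
have s3e : s3 e = e by rewrite permM s2e tpermR.
have s3e' : s3 e' = q by rewrite !permM -/q !tpermD ?ne.
(* The merge loses one cycle and each of the three splits gains one. *)
have Ns : ncycles s4 = (ncycles s).+2.
  rewrite ncycles_split ?ne -?s3e' ?porbit_perm1 //.
  rewrite ncycles_split ?ne -?s2e ?porbit_perm1 //.
  rewrite ncycles_split ?ne ?ncycles_merge //.
  rewrite (porbit_merge n13 ve) (porbit_merge n13 vre).
  by apply/eqP; rewrite porbit_mul_tperm // ?ne.
have Nf : ncycles (r * s4) = (ncycles (r * s)).+2.
  have f3e : porbit (r * s3) e' = porbit (r * s3) q.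
    by rewrite -porbit_perm1 permM re' s3e -porbit_perm1 permM s3e'.
  have f2e : porbit (r * s2) p = porbit (r * s2) e'.
    by rewrite -[RHS]porbit_perm1 permM re' s2e.
  (* Multiplying [r * s2] by [tperm e p] or by [tperm e e'] has the same effect
     on the number of cycles, and the latter gives back [r * s1]. *)
  rewrite mulgA ncycles_split ?ne // mulgA ncycles_mul_tperm ?ne // f2e.
  rewrite -ncycles_mul_tperm ?ne // -/s2 mulgA -[_ * _ * tperm e e']mulgA tperm2.
  by rewrite mulg1 mulgA ncycles_split ?ne.
have ts z : porbit s z != porbit s x1 -> porbit s z != porbit s x3 -> s4 z = s z.
  rewrite -(porbit_perm1 s z) s4E => nz1 nz3; rewrite !tpermD //;
  by apply/eqP=> E; move: nz1 nz3; rewrite -E ?vp ?vq ?ve ?vre eqxx.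
have q12 : eqclos (steps r s4) x1 x2.
  apply: eqclos_trans (eqclos_stepl _ _ _) _.
  rewrite def2 -(ts (r x1)); first exact: eqclos_stepr.
    by rewrite eq_sym sphere_loopless.
  by rewrite -porbit_perm1 -def2.
have q34 : eqclos (steps r s4) x3 x4.
  apply: eqclos_trans (eqclos_stepl _ _ _) _.
  rewrite def4 -(ts (r x3)); first exact: eqclos_stepr.
    by rewrite -porbit_perm1 -def4.
  by rewrite eq_sym sphere_loopless.
have q24 : eqclos (steps r s4) x2 x4.
  apply: linked_eqclos l24 => z zz; apply: ts;
  by case: zz => ->; rewrite // eq_sym.
have q31 : eqclos (steps r s4) x3 x1.
  by rewrite (eqclos_trans q34) // eqclos_sym (eqclos_trans q12).
have orb u v : porbit s4 u = porbit s4 v -> eqclos (steps r s4) u v.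
  by apply: eqclos_porbit => z _; apply: eqclos_stepr.
(* The darts left at the former ends of [e] stay attached: from [p], [s4] follows [s] up to the
   predecessor of [x1], which it sends to [x3]. The same holds for [q] with [x1] and [x3]
   exchanged. *)
have qp : eqclos (steps r s4) p x1.
  apply: eqclos_trans q31; apply/orb/(porbit_reroute (x := x1)); rewrite ?ne //.
    by move=> z sz; rewrite s4E sz tpermL !tpermD ?ne.
  move=> z; rewrite -porbit_perm1 s4E ve => vz nz1 nze nzp.
  have nz3 := diff _ _ vz (erefl _); have nzq := diff _ _ vz vq.
  have nze' := diff _ _ vz vre.
  by rewrite !tpermD ?nz3 ?nzq ?nze' // eq_sym.
have qq : eqclos (steps r s4) q x1.
  apply/orb/(porbit_reroute (x := x3)); rewrite ?ne //.
    by move=> z sz; rewrite s4E sz tpermR !tpermD ?ne.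
  move=> z; rewrite -porbit_perm1 s4E vre => vz nz3 nze' nzq.
  have nz1 := diff _ _ (erefl _) vz; have nzp := diff _ _ vp vz.
  have nze := diff _ _ ve vz.
  by rewrite !tpermD ?nz1 ?nzp ?nze // eq_sym.
have dom x : exists2 w, w \in [set x1; e] & eqclos (steps r s4) x w.
  pose P u := eqclos (steps r s4) u x1 || eqclos (steps r s4) u e.
  have Pinv u v : eqclos (steps r s4) u v -> P u = P v.
    by move=> uv; rewrite /P (eqclos_same x1 uv) (eqclos_same e uv).
  suff : P x by case/orP; [exists x1 | exists e]; rewrite ?set21 ?set22.
  have P1 : P x1 by rewrite /P eqclos_refl.
  have Pe : P e by rewrite /P eqclos_refl orbT.
  have Pe' : P e' by rewrite -(Pinv e) // eqclos_stepl.
  have Pp : P p by rewrite /P qp.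
  have Pq : P q by rewrite /P qq.
  have P3 : P x3 by rewrite /P q31.
  rewrite (eqclos_invariant _ (sphere_conn sphS x x1)) //.
  move=> u v /orP[]/eqP->; first exact/Pinv/eqclos_stepl.
  rewrite (Pinv u (s4 u)) ?eqclos_stepr // s4E !(@tperm_invariant _ _ P) //;
  by rewrite ?P1 ?P3 ?Pe ?Pe' ?Pp ?Pq.
have := genus_ineq dom; rewrite cards2 px1 Ns Nf; have := sphere_euler sphS.
by clear; lia.
Qed.

Lemma opposite_not_linked :
  x1 != x3 -> linked s x1 x3 -> ~~ linked s x2 x4.
Proof.
move=> n13 /orP[/eqP e13 | /existsP[e /andP[/eqP e1 /eqP e3]]].
  exact: same_vertex_not_linked.
have [e13 | v13] := eqVneq (porbit s x1) (porbit s x3).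
  exact: same_vertex_not_linked.
exact: adjacent_not_linked e1 e3.
Qed.

End DartPermutations.

(** * Choosing the chords by successive contraction *)

Section ChordSelection.

Variables (D : finType) (r : {perm D}).
Hypothesis rK : involutive r.
Implicit Types s : {perm D}.

Definition quads s := [set f in porbits (r * s) | #|f| == 4].

(** Steps of [s] join all darts of a vertex, so the equivalence closure is connectivity of vertices
    by chords from [A], expressed on darts. *)
Definition chord_steps s (c : {set D} -> D * D) (A : {set {set D}}) : rel D :=
  [rel x y | (y == s x) || [exists f in A, c f == (x, y)]].

Lemma quad_unlinked_pair s f : sphere_map r s -> f \in quads s ->
  exists x y, [/\ x \in f, y \in f & ~~ linked r s x y].
Proof.
move=> sphS; rewrite inE => /andP[/imsetP[x1 _ ->] /eqP card4].
have uniq4 := uniq_traject_porbit (r * s) x1.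
have := iter_porbit (r * s) x1; rewrite card4 /= in uniq4 *; rewrite !permM.
set x2 := s (r x1); set x3 := s (r x2); set x4 := s (r x3) => def1.
have {uniq4} [n13 n24] : x1 != x3 /\ x2 != x4.
  by move: uniq4; rewrite !permM !inE !negb_or; case/and4P=> /and3P[_ ? _] /andP[].
have orb i : ((r * s) ^+ i) x1 \in porbit (r * s) x1 by apply: mem_porbit.
have := (orb 0%N, orb 1%N, orb 2, orb 3); rewrite !permX /= !permM.
case=> [[[o1 o2] o3] o4].
have [l13 | n] := boolP (linked r s x1 x3); last by exists x1, x3.
exists x2, x4; split=> //.
exact: (opposite_not_linked rK sphS (erefl x2) (erefl x3) (erefl x4) (esym def1)).
Qed.

Section Merge.

Variables (s : {perm D}) (x y : D).
Hypothesis sphS : sphere_map r s.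
Hypothesis fxy : porbit (r * s) x = porbit (r * s) y.
Hypothesis card_f0 : #|porbit (r * s) x| = 4.
Hypothesis nlxy : ~~ linked r s x y.

Let t : {perm D} := s * tperm x y.

Lemma unlinked_porbit_neq : porbit s x != porbit s y.
Proof. by case/norP: nlxy. Qed.

Let nvxy := unlinked_porbit_neq.

Let nxy : x != y.
Proof. by apply: contraNneq nvxy => ->. Qed.

Lemma sphere_map_merge : sphere_map r t.
Proof.
split=> [|u v|d].
- have Nf : ncycles (r * t) = (ncycles (r * s)).+1.
    by rewrite mulgA; apply: ncycles_split.
  have := sphere_euler sphS; have : (ncycles t).+1 = _ := ncycles_merge nvxy.
  by rewrite Nf; clear; lia.
- apply: eqclos_sub (sphere_conn sphS u v) => a b /orP[]/eqP->.
    exact: eqclos_stepl.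
  apply: (eqclos_porbit (s := t)) => [z _|]; first exact: eqclos_stepr.
  by apply: porbit_merge; rewrite ?porbit_perm1.
(* [P] identifies the two merged vertices and is constant on the cycles of [t]. A loop of [t] thus
   comes from a loop of [s] or from an edge linking [x] and [y]. *)
pose P z := if porbit s z == porbit s y then porbit s x else porbit s z.
apply/eqP=> /(@porbit_invariant _ _ P) Pd.
have {Pd} : P d = P (r d).
  apply: Pd => z; rewrite permM tperm_invariant /P ?porbit_perm1 // eqxx.
  by case: ifP.
have unadj u : porbit s u = porbit s x -> porbit s (r u) = porbit s y -> False.
  move=> ux uy; case/norP: nlxy => _ /existsP[]; exists u.
  by rewrite ux uy !eqxx.
have nd := sphere_loopless sphS d; rewrite /P.
case: eqP => [dy|_]; case: eqP => [rdy|_].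
- by rewrite dy rdy eqxx in nd.
- by move=> dx; apply: (unadj (r d)); rewrite ?rK.
- by move=> dx; apply: (unadj d).
- by move=> ed; rewrite ed eqxx in nd.
Qed.

(** The transposition cuts the cycle of [x] and [y] into two proper parts, both of degree below 4,
    and leaves every other face as it is. *)
Lemma quads_merge : quads t = quads s :\ porbit (r * s) x.
Proof.
have defT : r * t = (r * s) * tperm x y by rewrite mulgA.
set f0 := porbit (r * s) x.
have sub z w : porbit (r * t) z = porbit (r * t) w ->
    porbit (r * s) z = porbit (r * s) w.
  apply: porbit_invariant => u.
  by rewrite defT permM tperm_invariant // porbit_perm1.
have out z : porbit (r * s) z != f0 -> porbit (r * t) z = porbit (r * s) z.
  move=> nz; apply/eqP; rewrite eqEsubset; apply/andP; split; apply/subsetP=> w.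
    by rewrite -!eq_porbit_mem => /eqP/sub->.
  rewrite -!eq_porbit_mem eq_sym => /eqP zw; rewrite eq_sym; apply/eqP.
  move: zw; apply: (porbit_invariant_in (P := porbit (r * t))) => u uz.
  rewrite -[RHS]porbit_perm1 defT [in RHS]permM tpermD //.
    by apply: contraNneq nz => E; rewrite /f0 E porbit_perm1 uz.
  by apply: contraNneq nz => E; rewrite /f0 fxy E porbit_perm1 uz.
have split_f0 : porbit (r * t) x != porbit (r * t) y.
  by rewrite defT porbit_mul_tperm // fxy eqxx.
apply/setP=> f; rewrite !inE; apply/andP/and3P=> [[/imsetP[z _ ->] c4]|].
  have [zf0 | nz] := eqVneq (porbit (r * s) z) f0; last first.
    by rewrite (out z nz) in c4 *; split=> //; apply: imset_f.
  have sub0 : porbit (r * t) z \subset f0.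
    by apply/subsetP=> w; rewrite -zf0 -!eq_porbit_mem => /eqP/sub->.
  have /eqP f0z : porbit (r * t) z == f0 by rewrite eqEcard sub0 (eqP c4) card_f0.
  case/eqP: split_f0; apply: (etrans (y := porbit (r * t) z)).
    by apply/eqP; rewrite eq_porbit_mem f0z porbit_id.
  by apply/esym/eqP; rewrite eq_porbit_mem f0z /f0 fxy porbit_id.
case=> nf /imsetP[z _ fz] c4; rewrite c4 fz -out ?imset_f //.
by rewrite -fz.
Qed.

End Merge.

(* Merging the endpoints of a chord of the quadrangle [f] replaces [f] by two
   digons and leaves the other faces unchanged, so that the chords of the merged
   map complete the chord of [f]. *)
Lemma chord_selection s : sphere_map r s ->
  exists c : {set D} -> D * D,
  [/\ forall f, f \in quads s -> (c f).1 \in f /\ (c f).2 \in f,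
      forall A : {set {set D}}, A \subset quads s -> A != set0 ->
        exists2 f, f \in A
                 & ~~ eqclos (chord_steps s c (A :\ f)) (c f).1 (c f).2
    & forall d, ~~ eqclos (chord_steps s c (quads s)) d (r d)].
Proof.
have [k] := ubnP #|quads s|; elim: k => // k IHk in s *; move=> le_k sphS.
have no_chord c x y :
    eqclos (chord_steps s c set0) x y -> porbit s x == porbit s y.
  move/(eqclos_invariant (P := fun z => porbit s z == porbit s y))->; rewrite ?eqxx //.
  move=> u v /orP[/eqP-> | /existsP[f]]; first by rewrite porbit_perm1.
  by rewrite inE.
have [Q0 | [f0 Qf0]] := set_0Vmem (quads s).
  (* A dart serves as default value of [c]; without darts Euler's formula would read [0 = 2]. *)
  have [x0 _ | D0] := pickP D; last first.
    have := sphere_euler sphS; have := (ncycles_le r, ncycles_le s, ncycles_le (r * s)).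
    by rewrite (eq_card0 D0) !leqn0 => -[[/eqP-> /eqP->] /eqP->].
  exists (fun _ => (x0, x0)); split=> [f|A|d]; rewrite Q0 ?inE //.
    by rewrite subset0 => /eqP->; rewrite eqxx.
  by apply/negP=> /no_chord; apply/negP/sphere_loopless.
have [x [y [f0x f0y nlxy]]] := quad_unlinked_pair sphS Qf0.
have [f0E card_f0] : f0 = porbit (r * s) x /\ #|porbit (r * s) x| = 4.
  move: Qf0; rewrite inE => /andP[/imsetP[z _ f0z] /eqP <-].
  suff -> : f0 = porbit (r * s) x by [].
  by apply/eqP; rewrite f0z eq_sym eq_porbit_mem -f0z.
have fxy : porbit (r * s) x = porbit (r * s) y.
  by apply/esym/eqP; rewrite eq_porbit_mem -f0E.
have nvxy := unlinked_porbit_neq nlxy.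
pose t : {perm D} := s * tperm x y.
have Qt : quads t = quads s :\ f0 by rewrite f0E; apply: quads_merge.
have [||c' [c'in c'forest c'adj]] := IHk t.
- by move: le_k; rewrite (cardsD1 f0) Qf0 -Qt.
- exact: sphere_map_merge.
pose c f := if f == f0 then (x, y) else c' f.
(* The chord of [f0] becomes trivial after the merge, since [x] and [y] then share a cycle of
   [t]. *)
have sub B u v : eqclos (chord_steps s c B) u v ->
    eqclos (chord_steps t c' (B :\ f0)) u v.
  apply: eqclos_sub => {u v} u v uv.
  have orb a b : porbit t a = porbit t b ->
      eqclos (chord_steps t c' (B :\ f0)) a b.
    by apply: eqclos_porbit => z _; apply: eqclos1; rewrite /chord_steps /= eqxx.
  case/orP: uv => [/eqP-> | /existsP[f /andP[Bf]]].
    by apply/orb/(porbit_merge nvxy); rewrite porbit_perm1.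
  rewrite /c; case: (eqVneq f f0) => [_ /eqP[<- <-] | nf cf].
    apply/orb/eqP; rewrite porbit_mul_tperm //.
    by apply: contraNneq nvxy => ->.
  by apply/eqclos1/orP; right; apply/existsP; exists f; rewrite !inE nf Bf.
exists c; split=> [f Qf | A sAQ A0 | d].
- rewrite /c; case: eqVneq => [-> // | nf]; apply: c'in.
  by rewrite Qt in_setD1 nf.
(* If [f0] is alone in [A], its chord joins two different vertices. Otherwise a bridge among the
   other chords in the merged map is still one before merging. *)
- have [A'0 | A'0] := eqVneq (A :\ f0) set0.
    have Af0 : f0 \in A.
      case/set0Pn: A0 => f Af; move/setP/(_ f): A'0; rewrite !inE Af andbT.
      by case: eqVneq => // <-.
    exists f0 => //; rewrite A'0 /c eqxx; apply/negP=> /no_chord.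
    exact/negP.
  have [|f A'f nf] := c'forest _ _ A'0; first by rewrite Qt setSD.
  move: (A'f); rewrite !inE => /andP[nff0 Af]; exists f => //.
  rewrite /c (negPf nff0); apply: contraNN nf => /sub.
  by rewrite !setDDl setUC.
- by apply: contraNN (c'adj d) => /sub; rewrite Qt.
Qed.

End ChordSelection.

(** * Transfer between orbits, connectivity and forests *)

Lemma porbit_fconnect (D : finType) (s : {perm D}) x y :
  (porbit s x == porbit s y) = fconnect s x y.
Proof.
rewrite eq_sym eq_porbit_mem; apply/porbitP/idP=> [[i ->] | xy].
  by rewrite permX fconnect_iter.
by exists (findex s x y); rewrite permX iter_findex.
Qed.

Lemma ncycles_fcard (D : finType) (s : {perm D}) : ncycles s = fcard s D.
Proof.
have symS : connect_sym (frel s) by apply/fconnect_sym/perm_inj.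
have -> : fcard s D = #|[set x | roots (frel s) x]|.
  by rewrite cardsE; apply: eq_card => x; rewrite !inE andbT.
rewrite -(card_in_imset (f := porbit s)) => [|x y]; last first.
  rewrite !inE => /eqP xr /eqP yr /eqP; rewrite porbit_fconnect.
  by move/(rootP symS); rewrite xr yr.
apply: eq_card => f; apply/imsetP/imsetP=> -[x _ ->]; last by exists x.
exists (froot s x); first by rewrite inE (roots_root symS).
by apply/eqP; rewrite porbit_fconnect connect_root.
Qed.

Section ConnectLift.

Variables (V D : finType) (src : D -> V) (g : rel V) (h : rel D).
Hypothesis fiber : forall x y, src x = src y -> eqclos h x y.
Hypothesis lift : forall u v, g u v ->
  exists d d', [/\ src d = u, src d' = v & eqclos h d d'].

(** A walk on vertices lifts edge by edge to darts; consecutive lifts are joined within the fiber of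
    [src]. *)
Lemma connect_lift x y : connect g (src x) (src y) -> eqclos h x y.
Proof.
case/connectP=> p; elim: p x => [|v p IHp] x /=; first by move=> _ /esym/fiber.
case/andP=> /lift[d [d' [dx <- dd']]] gp def_y.
by rewrite (eqclos_trans (fiber (esym dx))) // (eqclos_trans dd') // IHp.
Qed.

End ConnectLift.

(** The edge set of a cycle contains no bridge: the rest of the cycle bypasses each of its edges. *)
Lemma forest_bridge (V E : finType) (ends : E -> V * V) :
  (forall A : {set E}, A != set0 -> exists2 e, e \in A &
     ~~ connect [rel u v | [exists e' in A :\ e, joins ends e' u v]]
          (ends e).1 (ends e).2) ->
  forest ends.
Proof.
move=> bridge c; apply/negP=> /and4P[c0 _ uniqE cycC].
have [|e] := bridge [set e in unzip2 c].
  by case: c c0 {uniqE cycC} => // x c _; apply/set0Pn; exists x.2; rewrite !inE eqxx.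
rewrite inE => /mapP[x cx ->{e}] /negP[].
have [i c' def_c] := rot_to cx.
have {}cycC : path.cycle [rel x y | joins ends x.2 x.1 y.1] (x :: c').
  by rewrite -def_c rot_cycle.
have {}uniqE : uniq (unzip2 (x :: c')) by rewrite -def_c /unzip2 map_rot rot_uniq.
have memE e : e \in unzip2 c' -> e \in [set e in unzip2 c] :\ x.2.
  move=> c'e; rewrite !inE; apply/andP; split.
    by case/andP: uniqE => nx _; apply: contraNneq nx => <-.
  have <- : unzip2 (seq.rot i c) =i unzip2 c by move=> e'; rewrite /unzip2 map_rot mem_rot.
  by rewrite def_c inE c'e orbT.
set g := (X in connect X); set A := _ :\ _ in memE.
have symG : connect_sym g.
  by apply: sym_connect_sym => u v; apply: eq_existsb => e; rewrite /joins orbC.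
have tail y p : path [rel x y | joins ends x.2 x.1 y.1] y (rcons p x) ->
    {subset unzip2 (y :: p) <= A} -> connect g y.1 x.1.
  elim: p y => [|z p IHp] y /=.
    rewrite andbT => yx sA; apply: connect1; apply/existsP; exists y.2.
    by rewrite sA ?inE ?eqxx.
  case/andP=> yz pz sA; apply: (connect_trans (y := z.1)).
    by apply: connect1; apply/existsP; exists y.2; rewrite sA ?inE ?eqxx.
  by apply: IHp => // e ep; apply: sA; rewrite inE ep orbT.
have [z xz zx] : exists2 z, joins ends x.2 x.1 z & connect g z x.1.
  case: c' cycC memE {def_c uniqE} => [|y p] /=.
    by rewrite andbT => xx _; exists x.1.
  by case/andP=> xy py memE; exists y.1; last exact: tail py memE.
by case/orP: xz => /eqP->; rewrite //= symG.
Qed.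

(** * From the plane map to permutations *)

Section PlaneMap.

Variable H : plmap.

Let D := dart H.
Definition rev_perm : {perm D} := perm (can_inj (@Defs.revK H)).
Definition rot_perm : {perm D} := perm (@Defs.rot_inj H).

Let r := rev_perm.
Let s := rot_perm.

Lemma rev_permK : involutive r.
Proof. by move=> d; rewrite !permE Defs.revK. Qed.

Lemma porbit_rot_perm (x y : D) : (porbit s x == porbit s y) = (src x == src y).
Proof. by rewrite porbit_fconnect -rot_src; apply: eq_fconnect; apply: permE. Qed.

Lemma face_next_perm : face_next (H := H) =1 r * s.
Proof. by move=> d; rewrite permM !permE. Qed.

(** The dart [d0] excludes the edgeless map, whose single face is the empty set and not an orbit. *)
Lemma faces_porbits (d0 : D) : faces H = porbits (r * s).
Proof.
rewrite /faces; case: eqP => [/card0_eq/(_ d0)// | _].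
have faceE d : face_of d = porbit (r * s) d.
  apply/setP=> x; rewrite inE (eq_fconnect face_next_perm) -porbit_fconnect.
  by rewrite eq_sym eq_porbit_mem.
by apply/setP=> f; apply/imsetP/imsetP=> -[d _ ->]; exists d.
Qed.

Lemma n_edges_perm : n_edges H = ncycles r.
Proof. by rewrite ncycles_fcard; apply: eq_fcard => d; rewrite permE. Qed.

Lemma card_dart : #|D| = (n_edges H).*2.
Proof.
rewrite -muln2; apply/esym/fcard_order_set => [||d d'] //.
  exact: can_inj (@Defs.revK H).
apply/subsetP=> d _; rewrite inE; apply/eqP; apply: (order_cycle (p := [:: d; Defs.rev d])).
- by rewrite /= !Defs.revK !eqxx.
- by rewrite /= inE eq_sym rev_neq.
- by rewrite inE eqxx.
Qed.

Hypothesis conn : connected_graph H.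

(** Connectivity rules out isolated vertices once there is an edge: a path from [v] to [src d0] is
    empty or starts with a dart at [v]. *)
Lemma src_surj (d0 : D) (v : vertex H) : exists d : D, src d = v.
Proof.
have [_ /(_ v (src d0))/connectP[[|u p] /=]] := conn; first by exists d0.
by case/andP=> /existsP[d /andP[/eqP dv _]]; exists d.
Qed.

Lemma card_vertex (d0 : D) : #|vertex H| = ncycles s.
Proof.
pose F (v : vertex H) := [set d : D | src d == v].
rewrite -(card_imset (f := F) predT) => [|u v /setP Fuv]; last first.
  by have [d du] := src_surj d0 u; have := Fuv d; rewrite !inE du eqxx => /esym/eqP.
have FE d : porbit s d = F (src d).
  by apply/setP=> x; rewrite inE -eq_porbit_mem porbit_rot_perm.
apply: eq_card => f; apply/imsetP/imsetP=> -[v _ ->]; last by exists (src v).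
by have [d <-] := src_surj d0 v; exists d.
Qed.

Lemma plmap_sphere (d0 : D) : planar H -> loopless H -> sphere_map r s.
Proof.
move=> plH llH; split=> [|x y|d].
- move: plH; rewrite /planar (faces_porbits d0) (card_vertex d0) card_dart.
  by rewrite -n_edges_perm -/(ncycles (r * s)); clear; lia.
- have [_ /(_ (src x) (src y))] := conn; apply: connect_lift.
    move=> a b /eqP; rewrite -porbit_rot_perm => /eqP.
    by apply: eqclos_porbit => z _; apply: eqclos_stepr.
  move=> u v /existsP[d /andP[/eqP<- /eqP<-]]; exists d, (Defs.rev d); split=> //.
  by have := eqclos_stepl r s d; rewrite {2}/r permE.
- by rewrite porbit_rot_perm permE; apply: llH.
Qed.

End PlaneMap.

Theorem theorem6 (H : plmap) :
  connected_graph H -> planar H -> loopless H ->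
  (forall f : {set dart H}, f \in faces H -> face_degree f <= 4) ->
  exists c : quadrangle H -> dart H * dart H,
    [/\ forall q : quadrangle H, is_chord q (c q),
        forest (chord_ends c)
      & forall a b : vertex H, adjacent a b ->
          ~~ connect (edge_rel (chord_ends c)) a b].
Proof.
move=> conn plH llH _.
have [d0 _ | D0] := pickP (dart H); last first.
  have noquad (q : quadrangle H) : False.
    case: q => f /andP[_]; rewrite /face_degree => /eqP f4.
    by have := max_card f; rewrite f4 (eq_card0 D0).
  exists (fun q => False_rect _ (noquad q)); split=> [q | [|x ?] | a b].
  - by case: (noquad q).
  - by [].
  - by case: (noquad x.2).
  - by case/existsP=> d; have := D0 d.
have sphH := plmap_sphere conn d0 plH llH.
set r := rev_perm H in sphH; set s := rot_perm H in sphH.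
have rE d : r d = Defs.rev d by apply: permE.
have [c [c_in c_forest c_adj]] := chord_selection (@rev_permK H : involutive r) sphH.
have quadE (q : quadrangle H) : val q \in quads r s.
  by rewrite inE -(faces_porbits d0); apply: (valP q).
have fiber A x y : src x = src y -> eqclos (chord_steps s c A) x y.
  move/eqP; rewrite -porbit_rot_perm => /eqP; apply: eqclos_porbit => z _.
  by apply: eqclos1; rewrite /chord_steps /= eqxx.
pose cH (q : quadrangle H) := c (val q).
have joins_step (A : {set {set dart H}}) q u v : val q \in A ->
    joins (chord_ends cH) q u v ->
    exists d d', [/\ src d = u, src d' = v & eqclos (chord_steps s c A) d d'].
  move=> Aq; have cq : eqclos (chord_steps s c A) (cH q).1 (cH q).2.
    apply/eqclos1/orP; right; apply/existsP; exists (val q).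
    by rewrite Aq -surjective_pairing /=.
  case/orP=> /eqP[<- <-]; first by exists (cH q).1, (cH q).2.
  by exists (cH q).2, (cH q).1; rewrite eqclos_sym.
have nconn a b : adjacent a b -> ~~ connect (edge_rel (chord_ends cH)) a b.
  case/existsP=> d /andP[/eqP<- /eqP<-]; apply: contraNN (c_adj d).
  rewrite rE; apply: connect_lift; first exact: fiber.
  by move=> u v /existsP[q]; apply: joins_step.
(* A single chord is already a chord path, so its ends cannot be adjacent in [H]. *)
have chordN q u v : joins (chord_ends cH) q u v -> ~~ adjacent u v.
  move=> quv; apply/negP=> /nconn/negP[]; apply: connect1.
  by apply/existsP; exists q.
exists cH; split=> //.
  move=> q; have [q1 q2] := c_in _ (quadE q); split=> //.
    (* The bridge property of a single chord says that its ends are different vertices. *)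
    have [||f] := c_forest [set val q].
    - by rewrite sub1set.
    - by apply/set0Pn; exists (val q); rewrite inE.
    rewrite inE => /eqP->; apply: contraNneq; exact: fiber.
  by apply: (chordN q); rewrite /joins eqxx.
apply: forest_bridge => A A0; have [||f] := c_forest [set val q | q in A].
- by apply/subsetP=> _ /imsetP[q _ ->].
- by case/set0Pn: A0 => q Aq; apply/set0Pn; exists (val q); apply: imset_f.
case/imsetP=> q Aq -> nq; exists q => //; apply: contraNN nq.
apply: (connect_lift (src := @src H)); first exact: fiber.
move=> u v /existsP[q' /andP[]]; rewrite !inE => /andP[nq' Aq']; apply: joins_step.
by rewrite !inE (inj_eq val_inj) nq' imset_f.
Qed.
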